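(* Every group $(G,\cdot)$ is locally embeddable into the class of finite IP loops: for every finite subset $X\subseteq G$ there is a finite IP loop $(H,* )$ with $X\subseteq H$ and $x\cdot y=x*y$ for all $x,y\in X$ with $x\cdot y\in X$. Equivalently, every group embeds into some ultraproduct of finite IP loops.
   Context: An IP loop (loop with the inverse property) is a loop in which every element $x$ has a two-sided inverse $x^{-1}$ and the identities $x^{-1}(xy)=y=(yx)x^{-1}$ hold. *)

(* Defs.v *)
From mathcomp Require Import all_boot.
Set Implicit Arguments. Unset Strict Implicit. Unset Printing Implicit Defensive.

Definition is_group (G : Type) (mul : G -> G -> G) (e : G) (inv : G -> G) : Prop :=
  (forall x y z, mul x (mul y z) = mul (mul x y) z) /\
  (forall x, mul e x = x /\ mul x e = x) /\
  (forall x, mul (inv x) x = e /\ mul x (inv x) = e).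

Definition is_loop (H : Type) (mul : H -> H -> H) (e : H) : Prop :=
  (forall x, mul e x = x /\ mul x e = x) /\
  (forall a, bijective (mul a)) /\
  (forall a, bijective (fun x => mul x a)).

Definition is_IP_loop (H : Type) (mul : H -> H -> H) (e : H) : Prop :=
  is_loop mul e /\
  exists inv : H -> H,
    (forall x, mul x (inv x) = e /\ mul (inv x) x = e) /\
    (forall x y, mul (inv x) (mul x y) = y /\ mul (mul y x) (inv x) = y).

(* Main.v *)
Require Import Defs.
From mathcomp Require Import all_boot ssralg zmodp perm boolp.
From Stdlib Require Lists.List.
Set Implicit Arguments. Unset Strict Implicit. Unset Printing Implicit Defensive.

Import GRing.Theory.

(* An IP loop is encoded by t x y = (x y)^-1, so that its multiplication table
   is a system of triples (x, y, t x y) which is closed under rotation and under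
   (x, y, z) |-> (z^-1, y^-1, x^-1) and in which every pair starts exactly one
   triple. Such a system can be modified by trades: replacing some triples by
   others that cover the same pairs.

   Start with an injection f of the finite set B = X^{+-1} into an abelian group
   that respects inverses and cubes equal to 1, and repair the relations x y z = 1
   inside B one at a time, at each step replacing the loop H by a loop on
   H x (Z/2)^2 that contains B at level 0. If a, b, c are the images of x, y, z
   and a b c <> 1 in H, first twist H x (Z/2)^2 so that
   z' = (a b)^-1, x' = (b c)^-1 and y' = (c a)^-1 land on three different nonzero
   levels and so that x' y' z' = 1. Then the Pasch trade
     (a,b,z') (b,c,x') (c,a,y') (x',y',z')  ->  (a,b,c) (z',a,y') (x',b,z') (y',c,x')
   creates the triple (a,b,c). Since f also reflects the relations x y z = 1, the
   elements a b, b c, c a lie outside B, so only triples with an entry outside B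
   are destroyed and the relations already present inside B survive. *)

Lemma uniq_fibres (T K : eqType) (k : T -> K) (s : seq T) :
  (forall l, uniq [seq w <- s | k w == l]) -> uniq s.
Proof.
move=> us; apply: count_mem_uniq => w.
have := count_uniq_mem w (us (k w)); rewrite mem_filter eqxx /= => <-.
rewrite count_filter; apply: eq_count => v /=.
by case: eqP => [->|]; rewrite ?eqxx ?andbF.
Qed.

(** * IP loops as systems of triples *)

Definition ip_third (H : Type) (t : H -> H -> H) (i : H -> H) (e : H) : Prop :=
  [/\ involutive i, forall x, t e x = i x, forall x y, t y (t x y) = x
    & forall x y, t (i (t x y)) (i y) = i x].

Lemma ip_third_cyc2 (H : Type) (t : H -> H -> H) (i : H -> H) (e : H) x y :
  ip_third t i e -> t (t x y) x = y.
Proof. by case=> _ _ cyc _; have := cyc y (t x y); rewrite (cyc x y). Qed.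

Lemma ip_third_inv1 (H : Type) (t : H -> H -> H) (i : H -> H) (e : H) :
  ip_third t i e -> i e = e.
Proof. by case=> iK te _ rev; rewrite -[LHS](rev e e) te iK te iK. Qed.

(** Reversing the triple [(x, y, t x y)] gives the right inverse property; reversing and then
    rotating it gives the left one. Translations are bijective because those by inverses undo
    them. *)
Lemma ip_third_loop (H : Type) (t : H -> H -> H) (i : H -> H) (e : H) :
  ip_third t i e -> is_IP_loop (fun x y => i (t x y)) e.
Proof.
move=> ht; have [iK te cyc rev] := ht.
have cyc2 x y := ip_third_cyc2 x y ht; have i1 := ip_third_inv1 ht.
have left_inv x y : i (t (i x) (i (t x y))) = y.
  by rewrite -{1}(rev x y) cyc2 iK.
have right_inv x y : i (t (i (t y x)) (i x)) = y by rewrite rev iK.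
have te2 x : t x (i x) = e by rewrite -(te x) cyc.
have te3 x : t (i x) x = e by rewrite -{2}(iK x) te2.
have te4 x : t x e = i x by rewrite -(te3 x) cyc.
split; last first.
  by exists i; split=> [x|x y]; split; rewrite ?te2 ?te3 ?iK.
split=> [x|]; first by rewrite te te4 iK.
split=> a.
  exists (fun y => i (t (i a) y)) => x //=.
  by have := left_inv (i a) x; rewrite iK.
exists (fun y => i (t y (i a))) => x //=.
by have := right_inv (i a) x; rewrite iK.
Qed.

(** * Trades of triples *)

Section Trade.
Variables (H : eqType) (t : H -> H -> H) (i : H -> H) (e : H).

Definition cyc_rev_closed (D : seq (H * H * H)) :=
  forall p q r, (p, q, r) \in D -> (q, r, p) \in D /\ (i r, i q, i p) \in D.

Lemma mem_pairs (D : seq (H * H * H)) :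
  (forall p q r, (p, q, r) \in D -> t p q = r) ->
  forall p q, ((p, q) \in map fst D) = ((p, q, t p q) \in D).
Proof.
move=> tD p q; apply/mapP/idP => [[[[p1 q1] r1] h [-> ->]]|h].
  by rewrite (tD _ _ _ h).
by exists (p, q, t p q).
Qed.

Lemma mem_pairs_cyc (D : seq (H * H * H)) p q :
  ip_third t i e -> cyc_rev_closed D ->
  (forall p q r, (p, q, r) \in D -> t p q = r) ->
  ((q, t p q) \in map fst D) = ((p, q) \in map fst D).
Proof.
case=> _ _ cyc _ clD tD; rewrite !(mem_pairs tD) cyc.
by apply/idP/idP => [/clD[/clD[]]|/clD[]].
Qed.

Lemma mem_pairs_rev (D : seq (H * H * H)) p q :
  ip_third t i e -> cyc_rev_closed D ->
  (forall p q r, (p, q, r) \in D -> t p q = r) ->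
  ((i (t p q), i q) \in map fst D) = ((p, q) \in map fst D).
Proof.
case=> iK _ _ rev clD tD; rewrite !(mem_pairs tD) rev.
by apply/idP/idP => /clD[] //; rewrite !iK.
Qed.

(** The new operation reads the third entry off [D'] on traded pairs and is [t] elsewhere. As [D] is
    closed and covers the same pairs, rotation and reversal never lead from an untraded pair to a
    traded one. *)
Lemma ip_third_trade (D D' : seq (H * H * H)) :
  ip_third t i e -> cyc_rev_closed D -> cyc_rev_closed D' ->
  (forall p q r, (p, q, r) \in D -> t p q = r) ->
  map fst D =i map fst D' -> uniq (map fst D') ->
  (forall q, (e, q) \notin map fst D') ->
  exists t', [/\ ip_third t' i e, forall p q r, (p, q, r) \in D' -> t' p q = r
    & forall p q, (p, q) \notin map fst D' -> t' p q = t p q].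
Proof.
move=> ht clD clD' tD eqD uD' eD'; have [iK te cyc rev] := ht.
pose t' p q := if (p, q) \in map fst D'
  then (nth (p, q, p) D' (index (p, q) (map fst D'))).2 else t p q.
have t'_in p q r : (p, q, r) \in D' -> t' p q = r.
  move=> pqr; rewrite /t' (map_f fst pqr).
  set n := index (p, q, r) D'.
  have ltn : n < size D' by rewrite index_mem.
  have {2}-> : (p, q) = nth (p, q) (map fst D') n.
    by rewrite (nth_map (p, q, r)) // nth_index.
  by rewrite index_uniq ?size_map // (set_nth_default (p, q, r)) ?nth_index.
have t'_out p q : (p, q) \notin map fst D' -> t' p q = t p q.
  by rewrite /t' => /negbTE ->.
have t'P p q : (p, q) \in map fst D' -> (p, q, t' p q) \in D'.
  by case/mapP=> -[[p1 q1] r1] h [-> ->]; rewrite (t'_in _ _ _ h).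
exists t'; split=> //; split=> // [x|x y|x y]; first by rewrite t'_out // te.
- case: (boolP ((x, y) \in map fst D')) => [/t'P/clD'[/t'_in //]|h].
  by rewrite (t'_out _ _ h) t'_out ?cyc // -eqD (mem_pairs_cyc _ _ ht) ?eqD.
- case: (boolP ((x, y) \in map fst D')) => [/t'P/clD'[_ /t'_in //]|h].
  by rewrite (t'_out _ _ h) t'_out ?rev // -eqD (mem_pairs_rev _ _ ht) ?eqD.
Qed.

Definition orbit6 (p q r : H) : seq (H * H * H) :=
  [:: (p, q, r); (q, r, p); (r, p, q);
      (i r, i q, i p); (i q, i p, i r); (i p, i r, i q)].

Lemma orbit6_closed p q r : involutive i -> cyc_rev_closed (orbit6 p q r).
Proof.
move=> iK p1 q1 r1; rewrite /orbit6 !inE.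
by do ![case/orP] => /eqP[-> -> ->]; rewrite ?iK !eqxx ?orbT.
Qed.

Lemma cyc_rev_closed_cat D1 D2 :
  cyc_rev_closed D1 -> cyc_rev_closed D2 -> cyc_rev_closed (D1 ++ D2).
Proof.
move=> c1 c2 p q r; rewrite !mem_cat.
by case/orP=> [/c1|/c2] [-> ->]; rewrite ?orbT.
Qed.

Lemma orbit6_third p q r : ip_third t i e -> t p q = r ->
  forall p1 q1 r1, (p1, q1, r1) \in orbit6 p q r -> t p1 q1 = r1.
Proof.
move=> ht <- p1 q1 r1; have [iK te cyc rev] := ht.
have cyc2 x y := ip_third_cyc2 x y ht.
rewrite /orbit6 !inE; do ![case/orP] => /eqP[-> -> ->] //.
  by rewrite -(rev p q) cyc.
by rewrite -(rev p q) cyc2.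
Qed.

Lemma orbit6_pair_cyc p q r s : ip_third t i e ->
  ((s, t r s) \in map fst (orbit6 p q (t p q))) =
  ((r, s) \in map fst (orbit6 p q (t p q))).
Proof.
move=> ht; have [iK _ _ _] := ht; apply: mem_pairs_cyc => //.
  exact: orbit6_closed.
exact: orbit6_third.
Qed.

Lemma orbit6_pair_rev p q r s : ip_third t i e ->
  ((i (t r s), i s) \in map fst (orbit6 p q (t p q))) =
  ((r, s) \in map fst (orbit6 p q (t p q))).
Proof.
move=> ht; have [iK _ _ _] := ht; apply: mem_pairs_rev => //.
  exact: orbit6_closed.
exact: orbit6_third.
Qed.

Definition pasch (a b c x y z : H) :=
  orbit6 a b c ++ orbit6 z a y ++ orbit6 x b z ++ orbit6 y c x.

Lemma ip_third_pasch a b c x y z :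
  ip_third t i e -> t a b = z -> t b c = x -> t c a = y -> t x y = z ->
  uniq (map fst (pasch a b c x y z)) ->
  (forall q, (e, q) \notin map fst (pasch a b c x y z)) ->
  exists t', [/\ ip_third t' i e,
    forall p q r, (p, q, r) \in pasch a b c x y z -> t' p q = r
    & forall p q, (p, q) \notin map fst (pasch a b c x y z) -> t' p q = t p q].
Proof.
move=> ht hz hx hy hxy u he; have iK : involutive i by case: ht.
apply: (@ip_third_trade
  (orbit6 a b z ++ orbit6 b c x ++ orbit6 c a y ++ orbit6 x y z)) => //.
- by do 3?apply: cyc_rev_closed_cat; apply: orbit6_closed.
- by do 3?apply: cyc_rev_closed_cat; apply: orbit6_closed.
- move=> p q r; rewrite !mem_cat.
  by case/orP=> [|/orP[|/orP[]]]; apply: orbit6_third.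
case=> p q; rewrite /pasch /orbit6 /= !inE.
by apply/idP/idP; do ![case/orP]; move=> ->; rewrite ?orbT.
Qed.

End Trade.

(** * Twisted extension by the levels [(Z/2)^2] *)

Definition level : Type := bool * bool.

Definition ladd (u v : level) : level := (u.1 (+) v.1, u.2 (+) v.2).

(** The three nonzero levels form a line: any two of them add up to the third. *)
Definition line (u v : level) : bool :=
  [&& u != (false, false), v != (false, false) & u != v].

(* Naming (T,F), (F,T), (T,T) as levels 1, 2, 3, they are oriented 1 -> 2 -> 3 -> 1. *)
Definition lpos (u v : level) : bool :=
  (u, v) \in [:: ((true, false), (false, true)); ((false, true), (true, true));
                 ((true, true), (true, false))].

(* The level of the third element: u + v, shifted by w when both u and v lie in
   the subgroup {0, w}. The shift is symmetric in the three levels of a triple. *)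
Definition ltwist (w u v : level) : level :=
  if (u \in [:: (false, false); w]) && (v \in [:: (false, false); w])
  then ladd w (ladd u v) else ladd u v.

Lemma line_laddP u v : line u v ->
  [/\ line v (ladd u v), line (ladd u v) v, ladd v (ladd u v) = u,
      ladd (ladd u v) v = u
    & lpos v (ladd u v) = lpos u v /\ lpos (ladd u v) v = ~~ lpos u v].
Proof. by case: u v => [[] []] [[] []]. Qed.

Lemma nonline_ltwistP w u v : ~~ line u v ->
  [/\ ~~ line v (ltwist w u v), ~~ line (ltwist w u v) v,
      ltwist w v (ltwist w u v) = u & ltwist w (ltwist w u v) v = u].
Proof. by case: w u v => [[] []] [[] []] [[] []]. Qed.

Section Extension.
Variables (H : Type) (t : H -> H -> H) (i : H -> H) (e : H).
Variables (theta : H -> H -> level) (g : bool -> level -> H -> H).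

(* Triples over a line of levels use the multiplication of H relabelled by g;
   the others project to triples of H, with levels twisted by theta. *)
Definition ext_third (x y : H * level) : H * level :=
  let: (p, u) := x in let: (q, v) := y in
  if line u v then
    (g (lpos u v) (ladd u v) (t (g (lpos u v) u p) (g (lpos u v) v q)), ladd u v)
  else (t p q, ltwist (theta p q) u v).

Definition ext_inv (x : H * level) : H * level := (i x.1, x.2).

(** Rotation keeps the orientation of a line of levels and reversal flips it; hence the condition
    linking [g (~~ o)] to [g o] through [i]. *)
Lemma ip_third_ext : ip_third t i e ->
  (forall p q, theta q (t p q) = theta p q) ->
  (forall p q, theta (i (t p q)) (i q) = theta p q) ->
  (forall q, theta e q = (false, false)) ->
  (forall o u, involutive (g o u)) ->
  (forall o u p, g (~~ o) u (i p) = i (g o u p)) ->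
  ip_third ext_third ext_inv (e, (false, false)).
Proof.
case=> iK te cyc rev theta_cyc theta_rev theta_e gK g_i; split.
- by case=> p u; rewrite /ext_inv /= iK.
- by case=> p u; rewrite /= te theta_e; case: u => [[] []].
- case=> p u [q v] /=; case: (boolP (line u v)) => [|] uv.
    have [-> _ -> _ [-> _]] := line_laddP uv.
    by rewrite gK cyc gK.
  have [/negbTE-> _ vu _] := nonline_ltwistP (theta p q) uv.
  by rewrite theta_cyc vu cyc.
case=> p u [q v] /=; case: (boolP (line u v)) => [|] uv.
  have [_ h _ uE [_ o]] := line_laddP uv.
  by rewrite /ext_inv /= h uE o !g_i gK rev !g_i gK.
have [_ /negbTE h _ vu] := nonline_ltwistP (theta p q) uv.
by rewrite /ext_inv /= h theta_rev vu rev.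
Qed.

End Extension.

Lemma orbit6_neq_e (H : eqType) (t : H -> H -> H) (i : H -> H) (e p q r s : H) :
  ip_third t i e -> p != e -> q != e -> r != e ->
  (e, s) \notin map fst (orbit6 i p q r).
Proof.
move=> ht; have [iK _ _ _] := ht.
have i_neq_e u : u != e -> i u != e.
  by rewrite -{2}(ip_third_inv1 ht) (inj_eq (inv_inj iK)).
move=> pe qe re; rewrite /orbit6 /= !inE !xpair_eqE ![e == _]eq_sym.
by rewrite !(negbTE (i_neq_e _ _)) // (negbTE pe) (negbTE qe) (negbTE re).
Qed.

(** Pairs are compared one pair of levels at a time. Two nonzero levels carry at most one pair;
    level 0 with a nonzero level carries two, told apart by [a != i b] and its rotations; level 0
    twice carries the six pairs of the orbit of [(a, b, c)], which would also collide if
    [a = b = c]. *)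
Lemma uniq_pasch_ext (H : eqType) (i : H -> H) (a b c x y z : H) :
  involutive i -> a != i b -> b != i c -> c != i a ->
  ~~ ((a == b) && (b == c)) ->
  uniq (map fst (pasch (ext_inv i) (a, (false, false)) (b, (false, false))
    (c, (false, false)) (x, (true, false)) (y, (false, true)) (z, (true, true)))).
Proof.
move=> iK ab bc ca abc; have iI := inj_eq (inv_inj iK).
have sym_eq p q : (i p == q) = (p == i q) by rewrite -(iI p) iK.
have ab' := negbTE ab; have bc' := negbTE bc; have ca' := negbTE ca.
have ba' : (b == i a) = false by rewrite -sym_eq eq_sym.
have cb' : (c == i b) = false by rewrite -sym_eq eq_sym.
have ac' : (a == i c) = false by rewrite -sym_eq eq_sym.
have ba := eq_sym b a; have cb := eq_sym c b; have ac := eq_sym a c.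
apply: (@uniq_fibres _ _ (fun w : H * level * (H * level) => (w.1.2, w.2.2))).
case=> [[[] []] [[] []]] //=; rewrite ?inE ?xpair_eqE /= ?andbT ?andbF /=.
all: rewrite ?iI ?sym_eq ?ab' ?bc' ?ca' ?ba' ?cb' ?ac' ?andbF //.
rewrite ba cb ac; move: abc; case: (eqVneq a b) => [<-|nab _] /=.
  by rewrite [c == a]eq_sym => /negbTE->; rewrite !andbF.
by case: (eqVneq b c) => [<-|_]; rewrite ?[b == a]eq_sym ?(negbTE nab) ?andbF.
Qed.

(** * One repair step: creating the triple [(a, b, c)] *)

Section Step.
Variables (H : finType) (t : H -> H -> H) (i : H -> H) (e : H) (F : pred H).
Variables (a b c : H).
Hypothesis (ht : ip_third t i e) (Fi : forall p, F p -> F (i p)).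
Hypotheses (Fa : F a) (Fb : F b) (Fc : F c).
Hypotheses (ae : a != e) (be : b != e) (ce : c != e).
Hypotheses (ab : a != i b) (bc : b != i c) (ca : c != i a).
Hypothesis (abc : ~~ ((a == b) && (b == c))).
Hypotheses (Fz : ~~ F (t a b)) (Fx : ~~ F (t b c)) (Fy : ~~ F (t c a)).

Let iK : involutive i. Proof. by case: ht. Qed.

Let notFi p : ~~ F p -> ~~ F (i p).
Proof. by apply: contra => /Fi; rewrite iK. Qed.

(** The other four pairs of the orbit contain [r1] or [i r1], which lie outside [F]. *)
Let mem_orbit6F p q p1 q1 r1 : F p -> F q -> ~~ F r1 ->
  ((p, q) \in map fst (orbit6 i p1 q1 r1)) =
  ((p, q) == (p1, q1)) || ((p, q) == (i q1, i p1)).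
Proof.
move=> Fp Fq Fr; rewrite /orbit6 /= !inE !xpair_eqE.
have nr s : F s -> (s == r1) = false.
  by move=> Fs; apply: contraNF Fr => /eqP<-.
have nir s : F s -> (s == i r1) = false.
  by move=> Fs; apply: contraNF (notFi Fr) => /eqP<-.
by rewrite !nr // !nir // ?andbF ?andFb ?orbF ?orFb.
Qed.

(* Moves t a b, t b c and t c a to the levels 3, 1 and 2 when a, b, c are at
   level 0. *)
Let theta p q : level :=
  if (p, q) \in map fst (orbit6 i a b (t a b)) then (true, true)
  else if (p, q) \in map fst (orbit6 i b c (t b c)) then (true, false)
  else if (p, q) \in map fst (orbit6 i c a (t c a)) then (false, true)
  else (false, false).

Let theta_cyc p q : theta q (t p q) = theta p q.
Proof.
rewrite /theta.
by rewrite !(orbit6_pair_cyc _ _ _ _ ht).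
Qed.

Let theta_rev p q : theta (i (t p q)) (i q) = theta p q.
Proof. by rewrite /theta !(orbit6_pair_rev _ _ _ _ ht). Qed.

Let third_neq_e p q : p != i q -> t p q != e.
Proof.
move=> pq; apply: contra pq => /eqP E; have [_ te cyc _] := ht.
have := ip_third_cyc2 p q ht; rewrite E te => <-.
by rewrite iK.
Qed.

Let theta_e q : theta e q = (false, false).
Proof.
by rewrite /theta !(negbTE (orbit6_neq_e _ ht _ _ _)) ?third_neq_e.
Qed.

Let x := t b c.
Let y := t c a.
Let z := t a b.

(* Relabelling of level 3 that makes (x, y, z) at levels 1, 2, 3 a triple. *)
Let g (o : bool) (u : level) (p : H) : H :=
  if u == (true, true) then
    if o then tperm (t x y) z p else i (tperm (t x y) z (i p))
  else p.

Let gK o u : involutive (g o u).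
Proof. by rewrite /g => p; case: eqP => // _; case: o; rewrite ?iK tpermK ?iK. Qed.

Let g_i o u p : g (~~ o) u (i p) = i (g o u p).
Proof. by rewrite /g; case: eqP => // _; case: o; rewrite /= ?iK. Qed.

Let t1 := ext_third t theta g.
Let i1 := ext_inv i : H * level -> H * level.
Let l0 (p : H) : H * level := (p, (false, false)).
Let x1 : H * level := (x, (true, false)).
Let y1 : H * level := (y, (false, true)).
Let z1 : H * level := (z, (true, true)).

Let ht1 : ip_third t1 i1 (l0 e).
Proof. exact: ip_third_ext. Qed.

Let bca : ~~ ((b == c) && (c == a)).
Proof.
by apply: contra abc => /andP[/eqP-> /eqP->]; rewrite !eqxx. Qed.

Let cab : ~~ ((c == a) && (a == b)).
Proof.
by apply: contra abc => /andP[/eqP-> /eqP->]; rewrite !eqxx. Qed.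

Let t1ab : t1 (l0 a) (l0 b) = z1.
Proof. by rewrite /t1 /= /theta mem_orbit6F // eqxx. Qed.

Let sym_ne p q : p != i q -> (q == i p) = false.
Proof. by apply: contraNF => /eqP->; rewrite iK. Qed.

Let t1bc : t1 (l0 b) (l0 c) = x1.
Proof.
rewrite /t1 /= /theta !mem_orbit6F // !xpair_eqE eqxx /=.
(* The pair [(b, c)] must escape the first branch of [theta]: being [(a, b)] would force
   [a = b = c], and being [(i b, i a)] would force [c = i a]. *)
rewrite ![b == a]eq_sym ![c == b]eq_sym (negbTE abc).
by rewrite (negbTE ca) andbF eqxx.
Qed.

Let t1ca : t1 (l0 c) (l0 a) = y1.
Proof.
rewrite /t1 /= /theta !mem_orbit6F // !xpair_eqE eqxx /=.
rewrite (negbTE cab) (negbTE ab) (sym_ne bc).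
rewrite ![c == b]eq_sym ![a == c]eq_sym (negbTE bca) andbF /=.
by rewrite eqxx.
Qed.

(** Levels 1 and 2 are positively oriented, so [g] applies the transposition taking [t x y] to
    [z]. *)
Let t1xy : t1 x1 y1 = z1.
Proof. by rewrite /t1 /= /g /= tpermL. Qed.

Let pa := pasch i1 (l0 a) (l0 b) (l0 c) x1 y1 z1.

Let uniq_pa : uniq (map fst pa).
Proof. exact: uniq_pasch_ext. Qed.

Let pa_neq_e q : (l0 e, q) \notin map fst pa.
Proof.
have xe : x != e by rewrite third_neq_e.
have ye : y != e by rewrite third_neq_e.
have ze : z != e by rewrite third_neq_e.
have ne4 := orbit6_neq_e q ht1.
by rewrite /pa /pasch !map_cat !mem_cat !(negbTE (ne4 _ _ _ _ _ _)) //
  xpair_eqE negb_and ?ae ?be ?ce ?xe ?ye ?ze.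
Qed.

Let pa_l0 p q : ((l0 p, l0 q) \in map fst pa) =
  ((p, q) \in map fst (orbit6 i a b c)).
Proof.
rewrite /pa /pasch /orbit6 /i1 /ext_inv /l0 /x1 /y1 /z1 /=.
by rewrite !inE !xpair_eqE /= ?andbF ?andbT ?orbF.
Qed.

(** This is why the trade loses no relation inside [F]: the level 0 pairs it changes had their third
    element outside [F]. *)
Let third_notF p q :
  (p, q) \in map fst (orbit6 i a b c) -> ~~ F (t p q).
Proof.
have t_inv r s : t (i s) (i r) = i (t r s).
  have h : (i s, i r, i (t r s)) \in orbit6 i r s (t r s).
    by rewrite /orbit6 !inE eqxx !orbT.
  exact: (orbit6_third ht (erefl (t r s)) h).
rewrite /orbit6 /= !inE.
by do ![case/orP]; move=> /eqP[-> ->] //; rewrite t_inv notFi.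
Qed.

(** On pairs from [F], [theta] is nonzero only at the six pairs of the orbit of [(a, b, c)]. *)
Let t1_l0 p q : F p -> F q -> (p, q) \notin map fst (orbit6 i a b c) ->
  t1 (l0 p) (l0 q) = l0 (t p q).
Proof.
move=> Fp Fq; rewrite /orbit6 /= !inE !negb_or.
case/and5P=> /negbTE h1 /negbTE h2 /negbTE h3 /negbTE h4 /andP[/negbTE h5].
by move=> /negbTE h6; rewrite /t1 /= /theta !mem_orbit6F // h1 h2 h3 h4 h5 h6.
Qed.

(** [F] will be the image of [B]. The third clause preserves relations already present; the fourth
    bounds the new ones, so that relations are still reflected afterwards. *)
Lemma ip_third_step : exists (t' : H * level -> H * level -> H * level),
  [/\ ip_third t' (ext_inv i) (e, (false, false)),
      t' (a, (false, false)) (b, (false, false)) = (c, (false, false)),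
      forall p q, F p -> F q -> F (t p q) ->
        t' (p, (false, false)) (q, (false, false)) = (t p q, (false, false))
    & forall p q r, F p -> F q -> F r ->
        t' (p, (false, false)) (q, (false, false)) = (r, (false, false)) ->
        t p q = r \/ (p, q, r) \in orbit6 i a b c].
Proof.
have [t' [ht' t'in t'out]] :=
  ip_third_pasch ht1 t1ab t1bc t1ca t1xy uniq_pa pa_neq_e.
have t'_l0 p q : F p -> F q -> (p, q) \notin map fst (orbit6 i a b c) ->
    t' (l0 p) (l0 q) = l0 (t p q).
  move=> Fp Fq npq; rewrite -(t1_l0 Fp Fq npq); apply: t'out.
  by rewrite -/pa pa_l0.
exists t'; split=> //.
- by apply: t'in; rewrite mem_cat /orbit6 inE eqxx.
- move=> p q Fp Fq Fr; apply: t'_l0 => //.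
  by apply: contraL Fr => /third_notF.
move=> p q r Fp Fq Fr.
case: (boolP ((p, q) \in map fst (orbit6 i a b c))) => [|npq]; last first.
  by rewrite [t' _ _](t'_l0 p q Fp Fq npq) => -[]; left.
case/mapP=> -[[p1 q1] r1] h [-> ->] E2; right.
suff: (l0 p1, l0 q1, l0 r1) \in pa.
  by move/t'in=> E; have [r1r] := etrans (esym E) E2; rewrite -r1r.
rewrite mem_cat; apply/orP; left; move: h.
by rewrite /orbit6 !inE !xpair_eqE /= !andbT.
Qed.
End Step.

(** * Repairing the relations of a group *)

Section Groups.
Variables (G : eqType) (mul : G -> G -> G) (e : G) (inv : G -> G).
Hypothesis hG : is_group mul e inv.

Let mulA x y z : mul x (mul y z) = mul (mul x y) z.
Proof. by have [-> _] := hG. Qed.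
Let mul1 x : mul e x = x. Proof. by have [_ [/(_ x)[]]] := hG. Qed.
Let mulr1 x : mul x e = x. Proof. by have [_ [/(_ x)[]]] := hG. Qed.
Let mulV x : mul (inv x) x = e. Proof. by have [_ [_ /(_ x)[]]] := hG. Qed.
Let mulrV x : mul x (inv x) = e. Proof. by have [_ [_ /(_ x)[]]] := hG. Qed.

Let inv_uniq x y : mul x y = e -> y = inv x.
Proof. by move=> h; rewrite -[y]mul1 -(mulV x) -mulA h mulr1. Qed.

Let invK : involutive inv.
Proof. by move=> x; rewrite -(inv_uniq (mulV x)). Qed.

Let inv1 : inv e = e.
Proof. by rewrite -[LHS]mul1 mulrV. Qed.

Let cyc_group x y z : mul (mul x y) z = e -> mul (mul y z) x = e.
Proof. by rewrite -mulA => /inv_uniq ->; rewrite mulV. Qed.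

Let rev_group x y z : mul (mul x y) z = e ->
  mul (mul (inv z) (inv y)) (inv x) = e.
Proof.
by move/inv_uniq->; rewrite invK -(mulA x y) mulrV mulr1 mulrV.
Qed.

Section Embedding.
Variable B : seq G.
Hypotheses (eB : e \in B) (invB : forall x, x \in B -> inv x \in B).

(** Relations [x y z = 1] are reflected, and get realised one at a time. Cubes equal to 1 are
    respected from the start, because the pairs of a Pasch trade with [a = b = c] would repeat. *)
Definition good_embedding (H : finType) (t : H -> H -> H) (i : H -> H) (h : H)
    (f : G -> H) : Prop :=
  [/\ ip_third t i h, f e = h, {in B, forall x, f (inv x) = i (f x)},
      {in B &, injective f}
    & {in B & &, forall x y z, t (f x) (f y) = f z -> mul (mul x y) z = e} /\
      {in B, forall x, mul (mul x x) x = e -> t (f x) (f x) = f x}].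

Lemma good_embedding_step (H : finType) (t : H -> H -> H) (i : H -> H) (h : H)
    (f : G -> H) x y z :
  good_embedding t i h f -> x \in B -> y \in B -> z \in B ->
  mul (mul x y) z = e ->
  exists (H' : finType) (t' : H' -> H' -> H') (i' : H' -> H') (h' : H')
    (f' : G -> H'), [/\ good_embedding t' i' h' f', t' (f' x) (f' y) = f' z
    & {in B & &, forall p q r, t (f p) (f q) = f r -> t' (f' p) (f' q) = f' r}].
Proof.
move=> gf xB yB zB xyz; have [ht f1 fi injf [faith ord3]] := gf.
have [iK te cyc _] := ht.
case: (eqVneq (t (f x) (f y)) (f z)) => [txy|txy].
  by exists H, t, i, h, f; split=> // p q r _ _ _.
pose F : pred H := [pred p | p \in map f B].
have FB p : p \in B -> F (f p) by move=> pB; apply: map_f.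
have Fi p : F p -> F (i p).
  by case/mapP=> q qB ->; rewrite -fi //; apply/FB/invB.
have tE p : t p (i p) = h by rewrite -(te p) cyc.
(* If [p = 1] or [p = inv q], the relation holds in any loop. If [t (f p) (f q) = f s] with [s] in
   [B], reflection gives [p q s = 1], so [s = r]. *)
have unsat p q r : p \in B -> q \in B -> r \in B -> mul (mul p q) r = e ->
    t (f p) (f q) != f r ->
  [/\ f p != h, f p != i (f q) & ~~ F (t (f p) (f q))].
  move=> pB qB rB pqr npq; split.
  - apply: contra npq => /eqP; rewrite -f1 => /(injf _ _ pB eB) pe.
    by rewrite (inv_uniq pqr) pe f1 te -fi // mul1.
  - apply: contra npq; rewrite -fi // => /eqP/(injf _ _ pB (invB qB)) pE.
    move: pqr; rewrite pE mulV mul1 => ->.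
    by rewrite f1 fi // -{2}(iK (f q)) tE.
  - apply: contra npq => /mapP[s sB E]; rewrite E.
    by rewrite (inv_uniq (faith _ _ _ pB qB sB E)) (inv_uniq pqr).
have tyz : t (f y) (f z) != f x.
  by apply: contra txy => /eqP<-; rewrite (ip_third_cyc2 (f y) (f z) ht).
have tzx : t (f z) (f x) != f y.
  by apply: contra txy => /eqP<-; rewrite cyc.
have yzx := cyc_group xyz; have zxy := cyc_group yzx.
have [nx nxy nFz] := unsat _ _ _ xB yB zB xyz txy.
have [ny nyz nFx] := unsat _ _ _ yB zB xB yzx tyz.
have [nz nzx nFy] := unsat _ _ _ zB xB yB zxy tzx.
have nxyz : ~~ ((f x == f y) && (f y == f z)).
  apply: contra txy => /andP[/eqP/(injf _ _ xB yB) xy /eqP/(injf _ _ yB zB) yz].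
  by subst y z; rewrite ord3.
have [t' [ht' t'xy t'F t'F']] := ip_third_step ht Fi (FB x xB) (FB y yB)
  (FB z zB) nx ny nz nxy nyz nzx nxyz nFz nFx nFy.
pose f' p : H * level := (f p, (false, false)).
have keep : {in B & &, forall p q r,
    t (f p) (f q) = f r -> t' (f' p) (f' q) = f' r}.
  move=> p q r pB qB rB E; rewrite /f' -E; apply: t'F; try exact: FB.
  by rewrite E; exact: FB.
exists (H * level)%type, t', (ext_inv i), (h, (false, false)), f'.
split=> //; split=> //.
- by rewrite /f' f1.
- by move=> p pB; rewrite /f' fi.
- by move=> p q pB qB [] /injf ->.
split; last by move=> p pB ppp; apply: keep; rewrite ?ord3.
move=> p q r pB qB rB /(t'F' _ _ _ (FB p pB) (FB q qB) (FB r rB))[].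
  exact: faith.
(* A new triple lies in the orbit of [(f x, f y, f z)]; by injectivity on [B] it comes from a
   rotation or reversal of [x y z = 1], again a relation of [G]. *)
have img p1 q1 r1 : p1 \in B -> q1 \in B -> r1 \in B ->
    mul (mul p1 q1) r1 = e -> (f p, f q, f r) = (f p1, f q1, f r1) ->
    mul (mul p q) r = e.
  by move=> p1B q1B r1B pqr [/injf-> // /injf-> // /injf->].
have zyx := rev_group xyz; have yxz := cyc_group zyx.
have xzy := cyc_group yxz; rewrite /orbit6 !inE -!fi //.
by do ![case/orP]; move=> /eqP/img; apply; rewrite ?invB.
Qed.

(* x is sent to coef x times (delta_x - delta_(inv x)): order 2 for involutions,
   order 3 for elements of order 3, and order 12 otherwise, so that the only
   relations x y z = 1 holding between images already hold in G. *)
Let coef (x : G) : 'Z_12 :=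
  if x == inv x then 6%:R%R else if mul (mul x x) x == e then 4%:R%R else 1%R.

Let emb (x : G) : {ffun 'I_(size B) -> 'Z_12} :=
  [ffun j : 'I_(size B) => if x == e then 0%R else if nth e B j == x then coef x
             else if nth e B j == inv x then (- coef x)%R else 0%R].

Let emb_at u : u \in B -> exists j, forall x, emb x j =
  if x == e then 0%R else if u == x then coef x
  else if u == inv x then (- coef x)%R else 0%R.
Proof.
move=> uB; have ltu : index u B < size B by rewrite index_mem.
by exists (Ordinal ltu) => v; rewrite ffunE /= nth_index.
Qed.

Let coef_neq0 x : coef x != 0%R.
Proof. by rewrite /coef; case: ifP => // _; case: ifP. Qed.

Let coef2 x : (coef x + coef x == 0)%R = (x == inv x).
Proof. by rewrite /coef; case: ifP => // _; case: ifP. Qed.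

Let coef3 x : mul (mul x x) x != e -> (coef x + coef x + coef x != 0)%R.
Proof. by rewrite /coef => /negbTE->; case: ifP. Qed.

Let inv_eq x y : (inv x == y) = (x == inv y).
Proof. by rewrite -(inj_eq (inv_inj invK)) invK. Qed.

Let coefV x : coef (inv x) = coef x.
Proof.
rewrite /coef invK inv_eq; case: ifP => // _.
congr (if _ then _ else _); apply/eqP/eqP => /rev_group.
  by rewrite invK.
by [].
Qed.

Let emb1 : emb e = 0%R.
Proof. by apply/ffunP=> j; rewrite !ffunE eqxx. Qed.

Let embV x : emb (inv x) = (- emb x)%R.
Proof.
apply/ffunP=> j; rewrite !ffunE inv_eq inv1 coefV invK.
case: (x == e); first by rewrite oppr0.
case: (eqVneq _ x) => [->|_]; last by case: eqP => _; rewrite ?opprK ?oppr0.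
by case: eqP => // /eqP; rewrite -coef2 addr_eq0 => /eqP.
Qed.

Let emb_inj : {in B &, injective emb}.
Proof.
have emb_eq0 x : x \in B -> emb x = 0%R -> x = e.
  move=> xB x0; have [j /(_ x)] := emb_at xB; rewrite x0 ffunE eqxx.
  by case: eqP => // _ /esym/eqP; rewrite (negbTE (coef_neq0 x)).
move=> x y xB yB E; case: (eqVneq y e) => [ye|ye].
  by rewrite ye; apply: emb_eq0; rewrite // E ye emb1.
case: (eqVneq x e) => [xe|xe].
  by rewrite xe; apply/esym/emb_eq0; rewrite // -E xe emb1.
have [j ej] := emb_at xB; have := ej x; rewrite E ej eqxx.
rewrite (negbTE xe) (negbTE ye); case: eqP => // _.
case: eqP => [-> /esym/eqP|_ /esym/eqP]; last by rewrite (negbTE (coef_neq0 x)).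
by rewrite coefV -addr_eq0 coef2 => /eqP<-.
Qed.

(** If none of [x], [y], [z] is 1 and neither [y] nor [z] is [inv x], the coordinate of the sum at
    [x] is one, two or three times [coef x]. Only the triple multiple can vanish, and then
    [x = y = z] has cube 1. *)
Let emb_sum0 x y z : x \in B -> y \in B -> z \in B ->
  (emb x + emb y + emb z = 0)%R -> mul (mul x y) z = e.
Proof.
move=> xB yB zB sum0; have neg u v : u \in B -> v \in B ->
    (emb u + emb v = 0)%R -> v = inv u.
  move=> uB vB /eqP; rewrite addrC addr_eq0 -embV => /eqP/emb_inj-> //.
  exact: invB.
case: (eqVneq x e) => [xe|xe].
  by move: sum0; rewrite xe emb1 add0r mul1 => /neg-> //; rewrite mulrV.
case: (eqVneq y e) => [ye|ye].
  by move: sum0; rewrite ye emb1 addr0 mulr1 => /neg-> //; rewrite mulrV.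
case: (eqVneq z e) => [ze|ze].
  by move: sum0; rewrite ze emb1 addr0 mulr1 => /neg-> //; rewrite mulrV.
have yx : x != inv y.
  apply: contra ze => /eqP xy; apply/eqP/emb_inj => //.
  by move: sum0; rewrite emb1 xy embV addNr add0r.
have zx : x != inv z.
  apply: contra ye => /eqP xz; apply/eqP/emb_inj => //.
  by move: sum0; rewrite emb1 xz embV addrAC addNr add0r.
have [j ej] := emb_at xB.
have : (emb x j + emb y j + emb z j = 0)%R.
  by have /ffunP/(_ j) := sum0; rewrite !ffunE.
rewrite !ej eqxx (negbTE xe) (negbTE ye) (negbTE ze).
rewrite (negbTE yx) (negbTE zx).
have xx u : x = u -> x != inv u -> (coef x + coef x != 0)%R by move=> -> ?; rewrite coef2.
case: (eqVneq x y) => [xy|_]; case: (eqVneq x z) => [xz|_]; rewrite ?addr0 => /eqP.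
- by rewrite -xy -xz; apply: contraTeq => /coef3.
- by rewrite -xy (negbTE (xx y xy yx)).
- by rewrite -xz (negbTE (xx z xz zx)).
- by rewrite (negbTE (coef_neq0 x)).
Qed.

Lemma good_embedding_abelian :
  @good_embedding {ffun 'I_(size B) -> 'Z_12} (fun u v => - (u + v))%R -%R%R 0%R emb.
Proof.
split=> //.
- split=> [x|x|x y|x y]; rewrite ?opprK ?add0r //.
    by rewrite opprB addrK.
  by rewrite addrK.
split=> [x y z xB yB zB E|x xB xxx]; first by apply: emb_sum0; rewrite // -E subrr.
apply/ffunP=> j; rewrite !ffunE; case: eqP => [_|xe]; first by rewrite addr0 oppr0.
(* An [x] equal to its own inverse with cube 1 would be 1. So the coefficient is 4, and
   [-(4 + 4) = 4] modulo 12. *)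
have -> : coef x = 4%:R%R.
  rewrite /coef xxx eqxx; case: eqP => // xi.
  by case: xe; rewrite -xxx {3}xi mulrV mul1.
by case: eqP => _; last case: eqP => _; apply/eqP.
Qed.

Lemma good_embedding_all (L : seq (G * G * G)) :
  (forall x y z, (x, y, z) \in L ->
     [/\ x \in B, y \in B, z \in B & mul (mul x y) z = e]) ->
  exists (H : finType) (t : H -> H -> H) (i : H -> H) (h : H) (f : G -> H),
    good_embedding t i h f /\
    forall x y z, (x, y, z) \in L -> t (f x) (f y) = f z.
Proof.
elim: L => [|[[x y] z] L IH] LB.
  by do 5!eexists; split; [exact: good_embedding_abelian | by []].
have [|H [t [i [h [f [gf fL]]]]]] := IH.
  by move=> p q r pqr; apply: LB; rewrite inE pqr orbT.
have [xB yB zB xyz] := LB x y z (mem_head _ _).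
have [H' [t' [i' [h' [f' [gf' txy keep]]]]]] := good_embedding_step gf xB yB zB xyz.
exists H', t', i', h', f'; split=> // p q r; rewrite inE => /orP[/eqP[-> -> ->] //|pqr].
have [] := LB p q r; first by rewrite inE pqr orbT.
by move=> pB qB rB _; apply: keep => //; apply: fL.
Qed.

End Embedding.

(** * Local embedding of the group *)

Lemma locally_embeddable_IP_loop (X : seq G) :
  exists (H : finType) (hmul : H -> H -> H) (he : H),
    is_IP_loop hmul he /\
    exists2 f : G -> H, {in X &, injective f} &
      {in X &, forall x y, mul x y \in X -> f (mul x y) = hmul (f x) (f y)}.
Proof.
pose B := e :: X ++ map inv X.
have XB x : x \in X -> x \in B by rewrite inE mem_cat => ->; rewrite orbT.
have invB x : x \in B -> inv x \in B.
  rewrite !inE !mem_cat => /or3P[/eqP->|h|/mapP[y h ->]].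
  - by rewrite inv1 eqxx.
  - by rewrite (map_f inv h) !orbT.
  - by rewrite invK h orbT.
(* Realising [(x, y, inv (mul x y))] makes [t (f x) (f y)] the inverse of [f (mul x y)], so the loop
   product [i (t (f x) (f y))] is [f (mul x y)]. *)
pose L := [seq (u.1, u.2, inv (mul u.1 u.2)) |
  u <- [seq (x, y) | x <- X, y <- X] & mul u.1 u.2 \in X].
have [|H [t [i [h [f [[ht _ fi injf _] fL]]]]]] :=
  good_embedding_all (mem_head _ _) invB (L := L).
  move=> x y z /mapP[u]; rewrite mem_filter => /andP[uX /allpairsP[[x1 y1]]].
  move=> [/= x1X y1X uE] [-> -> ->]; rewrite {u}uE /= in uX *.
  by split; rewrite ?mulrV ?invB ?XB.
exists H, (fun u v => i (t u v)), h; split; first exact: ip_third_loop ht.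
have [iK _ _ _] := ht.
exists f => [x y /XB xB /XB yB|x y xX yX xyX]; first exact: injf.
rewrite (fL x y (inv (mul x y))) ?fi ?iK ?XB //.
apply/mapP; exists (x, y) => //; rewrite mem_filter xyX.
by apply/allpairsP; exists (x, y).
Qed.

End Groups.

(* Local embeddability of every group into the class of finite IP loops:
   for every finite subset X of G (given as a list) there is a finite IP loop
   (H, hmul) and an injection f of X into H preserving all products
   x * y that stay in X. *)
Theorem theorem2 (G : Type) (mul : G -> G -> G) (e : G) (inv : G -> G)
  (hG : is_group mul e inv) (X : list G) :
  exists (H : finType) (hmul : H -> H -> H) (he : H),
    is_IP_loop hmul he /\
    exists f : G -> H,
      (forall x y, Stdlib.Lists.List.In x X -> Stdlib.Lists.List.In y X -> f x = f y -> x = y) /\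
      (forall x y, Stdlib.Lists.List.In x X -> Stdlib.Lists.List.In y X -> Stdlib.Lists.List.In (mul x y) X ->
         f (mul x y) = hmul (f x) (f y)).
Proof.
(* [{classic G}] equips the arbitrary type [G] with a classical boolean equality. *)
have In_mem (s : seq {classic G}) (x : {classic G}) :
    Stdlib.Lists.List.In x s -> x \in s.
  elim: s => //= y s IH [->|/IH]; first exact: mem_head.
  by rewrite inE => ->; rewrite orbT.
have [H [hmul [he [loopH [f injf fM]]]]] :=
  @locally_embeddable_IP_loop {classic G} mul e inv hG X.
exists H, hmul, he; split=> //; exists f.
split=> [x y /In_mem xX /In_mem yX|x y /In_mem xX /In_mem yX /In_mem xyX].
  exact: injf.
exact: fM.
Qed.
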